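(* Let $\Omega=\Omega_t\times\Omega_s$ be decomposed into time and space, in dimension $n=1+3$, and let $F=\sum_{p=0}^4 f^p$ and $G=\sum_{p=0}^4 g^p$ be general fields on $\Omega$, with $f^p=f^p_t+f^p_s$ and $g^p=g^p_t+g^p_s$ the decompositions into time-like and space-like components, and with $f^p_t=\mathrm{d}t\wedge F^{p-1}_s$ and $g^p_t=\mathrm{d}t\wedge G^{p-1}_s$ for $p\ge 1$. Then the system $$ \begin{bmatrix} \mathrm{d}t\wedge\partial_t &0&0&0&0& \mathrm{d}^s_\nabla &0&0\\ 0&\star(\mathrm{d}t\wedge\partial_t)\star &0&0& \mathrm{d}^s_\nabla &0&0&0\\ 0&0&\mathrm{d}t\wedge\partial_t &0&0& -\star\mathrm{d}^s_\nabla\star &0& \mathrm{d}^s_\nabla\\ 0&0&0&\star(\mathrm{d}t\wedge\partial_t)\star & \star\mathrm{d}^s_\nabla\star &0& \mathrm{d}^s_\nabla &0\\ 0&\star\mathrm{d}^s_\nabla\star &0& \mathrm{d}^s_\nabla & \mathrm{d}t\wedge\partial_t &0&0&0\\ -\star\mathrm{d}^s_\nabla\star &0& \mathrm{d}^s_\nabla &0&0& -\star(\mathrm{d}t\wedge\partial_t)\star &0&0\\ 0&0&0&\star\mathrm{d}^s_\nabla\star &0&0& \mathrm{d}t\wedge\partial_t &0\\ 0&0&-\star\mathrm{d}^s_\nabla\star &0&0&0&0& -\star(\mathrm{d}t\wedge\partial_t)\star \end{bmatrix} \begin{bmatrix} f^3_s\\ f^4_t\\ f^1_s\\ f^2_t\\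 f^2_s\\ f^3_t\\ f^0\\ f^1_t\end{bmatrix} = \begin{bmatrix} g^4_t\\ g^3_s\\ g^2_t\\ g^1_s\\ g^3_t\\ g^2_s\\ g^1_t\\ g^0\end{bmatrix} $$ (the form of the general conservation law for $\{F,G\}$ in time and space) is equivalent to $$ \begin{bmatrix} \partial_t &0&0&0&0& -\mathrm{d}^s_\nabla &0&0\\ 0&\star_s\partial_t\star_s &0&0& \mathrm{d}^s_\nabla &0&0&0\\ 0&0&\partial_t &0&0& \star_s\mathrm{d}^s_\nabla\star_s &0& -\mathrm{d}^s_\nabla\\ 0&0&0&\star_s\partial_t\star_s & \star_s\mathrm{d}^s_\nabla\star_s &0& \mathrm{d}^s_\nabla &0\\ 0&\star_s\mathrm{d}^s_\nabla\star_s &0& -\mathrm{d}^s_\nabla & \partial_t &0&0&0\\ \star_s\mathrm{d}^s_\nabla\star_s &0& \mathrm{d}^s_\nabla &0&0& -\star_s\partial_t\star_s &0&0\\ 0&0&0&\star_s\mathrm{d}^s_\nabla\star_s &0&0& \partial_t &0\\ 0&0&\star_s\mathrm{d}^s_\nabla\star_s &0&0&0&0& -\star_s\partial_t\star_s \end{bmatrix} \begin{bmatrix} f^3_s\\ F^3_s\\ f^1_s\\ F^1_s\\ f^2_s\\ F^2_s\\ f^0\\ F^0\end{bmatrix} = \begin{bmatrix} G^3_s\\ g^3_s\\ G^1_s\\ g^1_s\\ G^2_s\\ g^2_s\\ G^0\\ g^0\end{bmatrix}, $$ where $F^0=F^0_s$ and $G^0=G^0_s$.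
   Context: Setting: $\Omega$ is an $n$-dimensional smooth oriented Minkowski manifold with metric tensor of signature $(-,+,\dots,+)$ (it may be assumed topologically trivial), here with $n=4$, decomposed into space and time as $\Omega=\Omega_t\times\Omega_s$. Here $\Omega_s$ is the space-like part, a 3-dimensional Riemannian manifold with metric $g_s$, and $\Omega_t$ is the time-like part, with time coordinate $t$. The metric is $-\mathrm{d}t^2+g_s$ and the orientation is that of $\mathrm{d}t\wedge\mathrm{vol}_{\Omega_s}$. $E$ is a smooth real vector bundle over $\Omega$ equipped with a metric, $E^*$ is its dual, and $\mathrm{End}(E)\cong E\otimes E^*$ is its endomorphism bundle. $\Gamma(\cdot)$ denotes the sections of a bundle. The maps $\flat:\Gamma(E)\to\Gamma(E^* )$ and $\sharp:\Gamma(E^* )\to\Gamma(E)$ are the flat and sharp maps of the metric on $E$. General field: a section of $\bigoplus_{p=0}^n\bigwedge^pT^*\Omega$, of $\bigoplus_{p=0}^n(E^p\otimes\bigwedge^pT^*\Omega)$ with $E^p$ either $E$ or $E^*$, or of $\bigoplus_{p=0}^n(\mathrm{End}(E)\otimes\bigwedge^pT^*\Omega)$. Its degree-$p$ component is written $f^p$ (respectively $g^p$), and ''$p$-form'' means an ordinary, $E$-valued, $E^*$-valued or $\mathrm{End}(E)$-valued $p$-form. Hodge operators: on ordinary forms $\star$ is the Hodge operator of the metric on $\Omega$. It is extended by $s\otimes\sigma\mapsto\flat s\otimes\star\sigma$ on $E$-valued forms, by $s\otimes\sigma\mapsto\sharp s\otimes\star\sigma$ on $E^*$-valued forms, and by $S\otimes\sigma\mapsto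 S\otimes\star\sigma$ on $\mathrm{End}(E)$-valued forms. $\star_s$ is the Hodge operator in the space-like component $\Omega_s$, extended to bundle-valued forms in the same way. With these conventions $\star(\mathrm{d}t\wedge F^{p-1}_s+f^p_s)=-\star_sF^{p-1}_s+(-1)^p\,\mathrm{d}t\wedge\star_sf^p_s$. Derivative: $\nabla$ is a connection and $\mathrm{d}_\nabla$ is the covariant exterior derivative; it reduces to the exterior derivative $\mathrm{d}$ if the connection is trivial (in particular for ordinary forms). It is decomposed as $\mathrm{d}_\nabla=\mathrm{d}t\wedge\partial_t+\mathrm{d}^s_\nabla$, where $\mathrm{d}t\wedge\partial_t$ is its time-like part and $\mathrm{d}^s_\nabla$ its space-like part. Decomposition of forms: for $p>0$, each $p$-form is uniquely $f^p=f^p_t+f^p_s$, where $f^p_s$ involves only space-like components (no factor $\mathrm{d}t$) and $f^p_t=\mathrm{d}t\wedge F^{p-1}_s$ contains the remaining components, with $F^{p-1}_s$ a space-like $(p-1)$-form. For $p=4$ one has $f^4=f^4_t$, and $0$-forms are not split. Likewise $g^p=g^p_t+g^p_s$ with $g^p_t=\mathrm{d}t\wedge G^{p-1}_s$. The forms $f^p_s,g^p_s,F^p_s,G^p_s$ are regarded as $p$-forms on $\Omega_s$ (depending on $t$). General conservation law: the differential equations $\mathrm{d}_\nabla F=0$ and $\star\mathrm{d}_\nabla\star F=\star\star G$ on $\Omega$ are said to form the general conservation law for the pair $\{F,G\}$ of general fields if the equations are derived from a real valued action (they arise by requiring the variation of the action to vanish). *)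

(* Defs.v *)
From HB Require Import structures.
From mathcomp Require Import all_boot all_order all_algebra.
From mathcomp Require Import all_classical all_reals all_analysis.
Set Implicit Arguments. Unset Strict Implicit. Unset Printing Implicit Defensive.
Import Order.TTheory GRing.Theory Num.Theory.
Import numFieldNormedType.Exports.
Local Open Scope classical_set_scope.
Local Open Scope ring_scope.

(* Manifolds and bundles are given by atlases.  A section is a family of local
   expressions, one per chart, related on overlaps by the transition law;
   differential and Hodge operators act on local expressions chart by chart,
   and two sections are equal when their expressions agree at every point of
   every chart. *)

Definition pderiv (R : realType) (n : nat) (k : 'I_n) (f : 'rV[R]_n -> R) :
  'rV[R]_n -> R := fun y => 'D_(delta_mx 0 k) f y.

(* C^infinity on the open set A: every iterated partial derivative is
   differentiable at every point of A. *)
Definition smooth_on (R : realType) (n : nat) (A : set 'rV[R]_n)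
    (f : 'rV[R]_n -> R) : Prop :=
  forall (s : seq 'I_n) (y : 'rV[R]_n), A y ->
    differentiable (foldr (@pderiv R n) f s) y.

Definition smooth_mx_on (R : realType) (n a b : nat) (A : set 'rV[R]_n)
    (f : 'rV[R]_n -> 'M[R]_(a, b)) : Prop :=
  forall i j, smooth_on A (fun y => f y i j).

(* A (mixed degree) form with values in V on an n-dimensional space is given by
   its coefficients on dx^K = dx^{k_1} /\ ... /\ dx^{k_p}, where
   K = {k_1 < ... < k_p} : {set 'I_n}; a p-form has coefficients supported on
   the K with p elements. *)

Definition dx_wedge (n : nat) (V : zmodType) (k : 'I_n) (w : {set 'I_n} -> V) :
    {set 'I_n} -> V :=
  fun K => if k \in K
           then w (K :\ k) *~ ((-1) ^+ #|[pred j in K | (j < k)%N]|) else 0.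

(* Minor of A with rows I and columns J, for #|I| = #|J|; the enumeration of a
   set of ordinals is increasing. *)
Definition minor (R : comNzRingType) (n : nat) (A : 'M[R]_n.+1)
    (I J : {set 'I_n.+1}) : R :=
  \det (\matrix_(a < #|I|, b < #|I|)
          A (nth ord0 (enum I) a) (nth ord0 (enum J) b)).

(* dx^I /\ dx^J = shuffle_sign I J . dx^(I :|: J) for disjoint I and J *)
Definition shuffle_sign (R : nzRingType) (n : nat) (I J : {set 'I_n}) : R :=
  (-1) ^+ #|[pred p : 'I_n * 'I_n | [&& p.1 \in I, p.2 \in J & (p.2 < p.1)%N]]|.

(* Hodge operator of the (pseudo-)metric with matrix g, for the orientation
   dx^0 /\ ... /\ dx^n, characterized by a /\ *b = <a, b> vol with
   vol = sqrt |det g| dx^0 /\ ... /\ dx^n; here <dx^I, dx^J> is the (I, J)-minor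
   of the inverse metric, and taking a = dx^I with I = ~: J isolates the
   coefficient of *b on dx^J. *)
Definition hodge (R : realType) (n : nat) (V : lmodType R) (g : 'M[R]_n.+1)
    (w : {set 'I_n.+1} -> V) : {set 'I_n.+1} -> V :=
  fun J => (Num.sqrt `|\det g| * shuffle_sign R (~: J) J) *:
    \sum_(I : {set 'I_n.+1} | #|I| == #|~: J|) minor (invmx g) (~: J) I *: w I.

(* Oriented Riemannian 3-manifold; gs i x is the matrix of the metric in the
   coordinates x of the chart i. *)
Record space (R : realType) := Space {
  pt : topologicalType;
  pt_hausdorff : hausdorff_space pt;
  pt_second_countable : @second_countable pt;
  chart : Type;
  dom : chart -> set pt;
  dom_open : forall i, open (dom i);
  dom_cover : forall m : pt, exists i, dom i m;
  coord : chart -> pt -> 'rV[R]_3;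
  param : chart -> 'rV[R]_3 -> pt;
  coordK : forall i m, dom i m -> param i (coord i m) = m;
  coord_open : forall i, open (coord i @` dom i);
  coord_continuous : forall i, {within dom i, continuous (coord i)};
  param_continuous : forall i, {within coord i @` dom i, continuous (param i)};
  coord_smooth : forall i j,
    smooth_mx_on (coord i @` (dom i `&` dom j)) (coord j \o param i);
  coord_oriented : forall i j x, (coord i @` (dom i `&` dom j)) x ->
    0 < \det ('J (coord j \o param i) x);
  gs : chart -> 'rV[R]_3 -> 'M[R]_3;
  gs_smooth : forall i, smooth_mx_on (coord i @` dom i) (gs i);
  gs_sym : forall i x, (coord i @` dom i) x -> (gs i x)^T = gs i x;
  gs_posdef : forall i x (u : 'rV[R]_3), (coord i @` dom i) x -> u != 0 ->
    0 < (u *m gs i x *m u^T) 0 0;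
  gs_change : forall i j x, (coord i @` (dom i `&` dom j)) x ->
    gs i x = 'J (coord j \o param i) x *m gs j (coord j (param i x))
              *m ('J (coord j \o param i) x)^T
}.

(* Omega = Omega_t x Omega_s; a point has coordinates y = (t, x) : 'rV_4, with
   t the coordinate of index 0. *)
Record spacetime (R : realType) := Spacetime {
  time : set R;
  time_open : open time;
  time_interval : is_interval time;
  slice :> space R
}.

Definition time_coord (R : realType) (y : 'rV[R]_4) : R := y 0 ord0.
Definition space_coord (R : realType) (y : 'rV[R]_4) : 'rV[R]_3 :=
  @rsubmx R 1 1 3 y.

Definition patch (R : realType) (M : spacetime R) (i : chart M) :
    set 'rV[R]_4 :=
  [set y | time M (time_coord y) /\ (coord i @` dom i) (space_coord y)].

Definition overlap (R : realType) (M : spacetime R) (i j : chart M) :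
    set 'rV[R]_4 :=
  [set y | time M (time_coord y) /\
           (coord i @` (dom i `&` dom j)) (space_coord y)].

Definition change (R : realType) (M : spacetime R) (i j : chart M)
    (y : 'rV[R]_4) : 'rV[R]_4 :=
  @row_mx R 1 1 3 (@lsubmx R 1 1 3 y) (coord j (param i (space_coord y))).

Definition spacetime_metric (R : realType) (M : spacetime R) (i : chart M)
    (y : 'rV[R]_4) : 'M[R]_4 :=
  @block_mx R 1 3 1 3 (- 1%:M) 0 0 (gs i (space_coord y)).

(* Rank r real vector bundle with fibre metric h and connection matrices A, in
   local frames over Omega_t x dom i (this is no restriction, Omega_t being an
   interval and charts of the atlas being allowed to be repeated).
   Coordinate columns of a section are related by s_i = tau i j s_j, and
   nabla_k s = partial_k s + A i k s.  The metric is only assumed to be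
   nondegenerate. *)
Record metric_bundle (R : realType) (M : spacetime R) (r : nat) :=
  MetricBundle {
  tau : forall i j : chart M, 'rV[R]_4 -> 'M[R]_r;
  tau_smooth : forall i j, smooth_mx_on (overlap i j) (tau i j);
  tau_id : forall i y, patch i y -> tau i i y = 1%:M;
  tau_cocycle : forall i j k y, overlap i j y -> overlap i k y ->
    tau i j y *m tau j k (change i j y) = tau i k y;
  h : chart M -> 'rV[R]_4 -> 'M[R]_r;
  h_smooth : forall i, smooth_mx_on (patch i) (h i);
  h_sym : forall i y, patch i y -> (h i y)^T = h i y;
  h_nondeg : forall i y, patch i y -> h i y \in unitmx;
  h_change : forall i j y, overlap i j y ->
    h j (change i j y) = (tau i j y)^T *m h i y *m tau i j y;
  A : chart M -> 'I_4 -> 'rV[R]_4 -> 'M[R]_r;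
  A_smooth : forall i k, smooth_mx_on (patch i) (A i k);
  A_change : forall i j k y, overlap i j y ->
    A i k y *m tau i j y =
      tau i j y *m \sum_(l < 4) 'J (change i j) y k l *: A j l (change i j y)
      - \matrix_(a, b) pderiv k (fun z => tau i j z a b) y
}.

(* The bundles in which forms take values: the trivial line bundle, E, its dual
   and its endomorphisms.  Elements of E are columns, elements of the dual are
   rows, scalars are 1 x 1 matrices. *)
Inductive values := Scalar | InE | InDual | InEnd.

Definition dual (v : values) : values :=
  match v with
  | Scalar => Scalar | InE => InDual | InDual => InE | InEnd => InEnd
  end.

Definition nrows (r : nat) (v : values) : nat :=
  match v with Scalar => 1 | InE => r | InDual => 1 | InEnd => r end.
Definition ncols (r : nat) (v : values) : nat :=
  match v with Scalar => 1 | InE => 1 | InDual => r | InEnd => r end.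

Notation fibre R r v := ('M[R]_(nrows r v, ncols r v)).

Definition frame_change (R : realType) (r : nat) (v : values) (T : 'M[R]_r) :
    fibre R r v -> fibre R r v :=
  match v return fibre R r v -> fibre R r v with
  | Scalar => fun s => s
  | InE => fun s => T *m s
  | InDual => fun s => s *m invmx T
  | InEnd => fun s => T *m s *m invmx T
  end.

(* Induced connections on the dual and on the endomorphisms. *)
Definition connection_act (R : realType) (r : nat) (v : values) (B : 'M[R]_r) :
    fibre R r v -> fibre R r v :=
  match v return fibre R r v -> fibre R r v with
  | Scalar => fun=> 0
  | InE => fun s => B *m s
  | InDual => fun s => - (s *m B)
  | InEnd => fun s => B *m s - s *m B
  end.

(* The action of the Hodge operators on values: flat on E, sharp on the dual,
   the identity on scalars and endomorphisms. *)
Definition musical (R : realType) (r : nat) (v : values) (H : 'M[R]_r) :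
    fibre R r v -> fibre R r (dual v) :=
  match v return fibre R r v -> fibre R r (dual v) with
  | Scalar => fun s => s
  | InE => fun s => s^T *m H
  | InDual => fun s => invmx H *m s^T
  | InEnd => fun s => s
  end.

(* Local expressions; n = 4 for forms on Omega, and n = 3 for forms on Omega_s
   depending on t, the latter being also functions of y = (t, x). *)
Definition lform (R : realType) (M : spacetime R) (r : nat)
    (E : metric_bundle M r) (n : nat) (v : values) : Type :=
  chart M -> 'rV[R]_4 -> {set 'I_n} -> fibre R r v.

Section Operators.
Context {R : realType} {M : spacetime R} {r : nat} {E : metric_bundle M r}.
Context {v : values}.

Definition form_eq {n : nat} (a b : lform E n v) : Prop :=
  forall i y, patch i y -> forall K, a i y K = b i y K.

Definition add {n : nat} (a b : lform E n v) : lform E n v :=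
  fun i y K => a i y K + b i y K.
Definition opp {n : nat} (a : lform E n v) : lform E n v :=
  fun i y K => - a i y K.

Definition nabla {n : nat} (k : 'I_4) (w : lform E n v) : lform E n v :=
  fun i y K => \matrix_(a, b) pderiv k (fun z => w i z K a b) y
               + connection_act (A E i k y) (w i y K).

(* The convention is d_nabla (s (x) sigma) = nabla s /\ sigma + s (x) d sigma,
   and the dx^K are closed.  The time derivative is the covariant one. *)
Definition d_nabla (w : lform E 4 v) : lform E 4 v :=
  fun i y K => \sum_(k < 4) dx_wedge k (nabla k w i y) K.

Definition dt_wedge (w : lform E 4 v) : lform E 4 v :=
  fun i y => dx_wedge ord0 (w i y).

Definition dt_partial_t (w : lform E 4 v) : lform E 4 v :=
  dt_wedge (nabla ord0 w).

Definition ds (w : lform E 4 v) : lform E 4 v :=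
  fun i y K => \sum_(k < 3) dx_wedge (lift ord0 k) (nabla (lift ord0 k) w i y) K.

Definition partial_t (a : lform E 3 v) : lform E 3 v := nabla ord0 a.

Definition d_s (a : lform E 3 v) : lform E 3 v :=
  fun i y K => \sum_(k < 3) dx_wedge k (nabla (lift ord0 k) a i y) K.

Definition star (w : lform E 4 v) : lform E 4 (dual v) :=
  fun i y K => musical (h E i y) (hodge (spacetime_metric i y) (w i y) K).

Definition star_s (a : lform E 3 v) : lform E 3 (dual v) :=
  fun i y K => musical (h E i y) (hodge (gs i (space_coord y)) (a i y) K).

(* Form on Omega_s seen as a form on Omega without factor dt *)
Definition on_Omega (a : lform E 3 v) : lform E 4 v :=
  fun i y K => if ord0 \in K then 0
               else a i y (lift ord0 @^-1: K).

(* w = dt /\ W + w_s, with W = time_coef w and w_s = space_coef w *)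
Definition space_coef (w : lform E 4 v) : lform E 3 v :=
  fun i y K => w i y (lift ord0 @: K).
Definition time_coef (w : lform E 4 v) : lform E 3 v :=
  fun i y K => w i y (ord0 |: (lift ord0 @: K)).

Definition space_part (w : lform E 4 v) : lform E 4 v :=
  on_Omega (space_coef w).
Definition time_part (w : lform E 4 v) : lform E 4 v :=
  dt_wedge (on_Omega (time_coef w)).

End Operators.

(* The star operators on forms with values in dual v, with result valued in v:
   dual (dual v) is v, but not by conversion for a variable v. *)
Definition undual (R : realType) (M : spacetime R) (r : nat)
    (E : metric_bundle M r) (n : nat) (v : values) :
    lform E n (dual (dual v)) -> lform E n v :=
  match v return lform E n (dual (dual v)) -> lform E n v with
  | Scalar => id | InE => id | InDual => id | InEnd => id
  end.

Definition costar (R : realType) (M : spacetime R) (r : nat)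
    (E : metric_bundle M r) (v : values) (w : lform E 4 (dual v)) :
  lform E 4 v := undual (star w).
Definition costar_s (R : realType) (M : spacetime R) (r : nat)
    (E : metric_bundle M r) (v : values) (a : lform E 3 (dual v)) :
  lform E 3 v := undual (star_s a).

Record pform (R : realType) (M : spacetime R) (r : nat)
    (E : metric_bundle M r) (v : values) (p : nat) := PForm {
  pform_expr :> lform E 4 v;
  pform_degree : forall i y (K : {set 'I_4}), patch i y -> #|K| != p ->
    pform_expr i y K = 0;
  pform_smooth : forall i K, smooth_mx_on (patch i) (fun y => pform_expr i y K);
  pform_change : forall i j y (I : {set 'I_4}), overlap i j y ->
    pform_expr i y I =
      \sum_(J : {set 'I_4} | #|J| == #|I|)
         minor ('J (change i j) y) I J *:
           frame_change (tau E i j y) (pform_expr j (change i j y) J)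
}.

(* The three kinds of general fields.  The operators d and * d * change the
   parity of the degree and preserve values, so that the equations relate
   components of F of the same parity only; hence the choice between E and its
   dual in degree p is a function of the parity of p. *)
Inductive field_kind :=
  | OrdinaryField
  | BundleField of bool -> bool
  | EndField.

Definition values_of (k : field_kind) (odd_degree : bool) : values :=
  match k with
  | OrdinaryField => Scalar
  | BundleField c => if c odd_degree then InDual else InE
  | EndField => InEnd
  end.

(* Degrees p > 4 contribute nothing: there is no K : {set 'I_4} with more than
   four elements. *)
Definition general_field (R : realType) (M : spacetime R) (r : nat)
    (E : metric_bundle M r) (vals : bool -> values) : Type :=
  forall p : nat, pform E (vals (odd p)) p.

Notation "a =f b" := (form_eq a b) (at level 70).
Notation "a +f b" := (add a b) (at level 50, left associativity).
Notation "-f a" := (opp a) (at level 35, a at level 35).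

Lemma d_nabla_split (R : realType) (M : spacetime R) (r : nat)
    (E : metric_bundle M r) (v : values) (w : lform E 4 v) :
  d_nabla w =f dt_partial_t w +f ds w.
Proof. by move=> i y _ K; rewrite /d_nabla big_ord_recl. Qed.

Lemma lift0_imset (K : {set 'I_4}) : ord0 \notin K ->
  lift ord0 @: (lift ord0 @^-1: K) = K.
Proof.
move=> K0; apply/setP => k; apply/imsetP/idP => [[j]|kK].
  by rewrite inE => jK ->.
case: (unliftP ord0 k) kK K0 => [j ->|->] kK; last by rewrite kK.
by move=> _; exists j; rewrite ?inE.
Qed.

Lemma part_split (R : realType) (M : spacetime R) (r : nat)
    (E : metric_bundle M r) (v : values) (w : lform E 4 v) :
  w =f time_part w +f space_part w.
Proof.
move=> i y _ K; rewrite /add /time_part /space_part /dt_wedge /dx_wedge.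
rewrite /on_Omega /time_coef /space_coef.
case: ifPn => K0.
  rewrite eq_card0 ?mulr1z; last by move=> j; rewrite !inE ltn0 andbF.
  rewrite !inE eqxx /= addr0; congr (w i y _).
  have N0 : ord0 \notin K :\ ord0 by rewrite !inE eqxx.
  by rewrite lift0_imset // finset.setD1K.
by rewrite add0r lift0_imset.
Qed.

Lemma part_uniq (R : realType) (M : spacetime R) (r : nat)
    (E : metric_bundle M r) (v : values) (a b : lform E 3 v) :
  time_coef (dt_wedge (on_Omega a) +f on_Omega b) =f a /\
  space_coef (dt_wedge (on_Omega a) +f on_Omega b) =f b.
Proof.
have im0 (K : {set 'I_3}) : (@ord0 3 \in (lift ord0 @: K)) = false.
  by apply/negP => /imsetP[k _ /eqP]; rewrite (negPf (neq_lift _ _)).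
have imK (K : {set 'I_3}) :
    lift (@ord0 3) @^-1: (lift ord0 @: K) = K.
  by apply/setP => k; rewrite inE mem_imset //; exact: lift_inj.
split=> i y _ K;
  rewrite /time_coef /space_coef /add /dt_wedge /dx_wedge /on_Omega.
  rewrite !inE eqxx /= addr0 finset.setU1K ?im0 // imK.
  rewrite eq_card0 ?mulr1z // => j; by rewrite !inE ltn0 andbF.
by rewrite im0 add0r imK.
Qed.

(* Main.v *)
Require Import Defs.
From mathcomp Require Import all_boot all_order all_algebra.
From mathcomp Require Import all_classical all_reals all_analysis.
Set Implicit Arguments. Unset Strict Implicit. Unset Printing Implicit Defensive.
Import Order.TTheory GRing.Theory Num.Theory.
Import numFieldNormedType.Exports.
Local Open Scope ring_scope.

(* Both systems are the same identities of spatial forms.  On the block metric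
   -dt^2 + g_s, writing a, b for space-like forms and b^# for the form b with
   its degree p part multiplied by (-1)^p,
     *(dt /\ a) = - *_s a,            *b = dt /\ *_s b^#,
     d^s (dt /\ a) = - dt /\ d_s a,   d^s b = d_s b,
   and since # anticommutes with *_s and d_s (in dimension 3),
     * d^s * (dt /\ a) = - dt /\ *_s d_s *_s a^#,
     * d^s * b = *_s d_s *_s b^#,
     * (dt /\ d_t) * (dt /\ a) = *_s d_t *_s a.
   Every row therefore has the form dt /\ X = dt /\ Y or X = Y with X, Y
   space-like, and the components F^p_s, f^p_s being homogeneous turns # into
   the signs of the second system. *)

(** * The Hodge operator of a block metric *)

Lemma enum_filter_ord n (I : {set 'I_n}) : enum I = [seq i <- enum 'I_n | i \in I].
Proof. by rewrite enumT /enum_mem; apply: eq_filter. Qed.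

(** Enumerations are increasing, so 0 comes first when present. The index 0 thus gives the first row
    or column of a minor, the one to expand along. *)
Lemma enum_ord_lift n (I : {set 'I_n.+1}) :
  enum I = nseq (ord0 \in I) ord0 ++
           [seq lift ord0 i | i <- enum (lift ord0 @^-1: I)].
Proof.
rewrite !enum_filter_ord enum_ordSl /= filter_map.
rewrite (@eq_filter _ (preim _ _) [in lift ord0 @^-1: I]); last first.
  by move=> i; rewrite /= !inE.
by case: (ord0 \in I).
Qed.

Lemma card_ord_lift n (I : {set 'I_n.+1}) :
  #|I| = ((ord0 \in I) + #|lift ord0 @^-1: I|)%N.
Proof. by rewrite !cardE enum_ord_lift size_cat size_nseq size_map. Qed.

(** The size of the matrix in [minor] is the term [#|I|]; naming it m allows a case analysis on the
    cardinal without rewriting in a dependent type. *)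
Lemma minorE (R : comNzRingType) n (A : 'M[R]_n.+1) (I J : {set 'I_n.+1}) m :
  m = #|I| -> minor A I J =
  \det (\matrix_(a < m, b < m) A (nth ord0 (enum I) a) (nth ord0 (enum J) b)).
Proof. by move=> ->. Qed.

Lemma block_mx_lift (R : nzRingType) n (c : R) (g : 'M[R]_n.+1) :
  let G := block_mx c%:M 0 0 g : 'M[R]_(1 + n.+1) in
  [/\ G ord0 ord0 = c, forall b, G ord0 (lift ord0 b) = 0,
      forall a, G (lift ord0 a) ord0 = 0 &
      forall a b, G (lift ord0 a) (lift ord0 b) = g a b].
Proof.
have e0 : ord0 = lshift n.+1 (0 : 'I_1) by apply: val_inj.
have eL a : lift ord0 a = @rshift 1 n.+1 a by apply: val_inj.
split=> [|b|a|a b]; rewrite ?eL ?e0 ?block_mxEul ?block_mxEur ?block_mxEdl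
  ?block_mxEdr ?mxE ?mulr1n //.
Qed.

Lemma nth_enum_lift n (I : {set 'I_n.+1}) i : (i < #|I|)%N ->
  nth ord0 [seq lift ord0 j | j <- enum I] i = lift ord0 (nth ord0 (enum I) i).
Proof. by move=> iI; rewrite (nth_map ord0) // -cardE. Qed.

(** If 0 lies in both sets, the first row of the minor has c as its only nonzero entry, and Laplace
    expansion removes it. If 0 lies in exactly one, the first row or column vanishes. If it lies in
    neither, only entries of g occur. *)
Lemma minor_block (R : comNzRingType) n (c : R) (g : 'M[R]_n.+1)
    (I J : {set 'I_n.+2}) : #|I| = #|J| ->
  minor (block_mx c%:M 0 0 g : 'M[R]_(1 + n.+1)) I J =
  if (ord0 \in I) == (ord0 \in J)
  then c ^+ (ord0 \in I) * minor g (lift ord0 @^-1: I) (lift ord0 @^-1: J)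
  else 0.
Proof.
have [] := block_mx_lift c g.
move: (block_mx _ _ _ _) => G G00 G0l Gl0 Gll.
rewrite (card_ord_lift I) (card_ord_lift J).
have := card_ord_lift I; have := enum_ord_lift I; have := enum_ord_lift J.
case: (ord0 \in I); case: (ord0 \in J); rewrite /= ?add1n ?add0n => eJ eI cI.
- case=> IJ; rewrite (minorE _ _ (esym cI)) (expand_det_row _ ord0).
  rewrite big_ord_recl big1 => [|j _]; last first.
    by rewrite !mxE eI eJ /= add0n nth_enum_lift -?IJ // G0l mul0r.
  rewrite addr0 !mxE eI eJ G00 expr1 /cofactor expr0 mul1r; congr (_ * \det _).
  by apply/matrixP => a b; rewrite !mxE /= !add0n !nth_enum_lift -?IJ.
- move=> IJ; rewrite (minorE _ _ (esym cI)) (expand_det_row _ ord0).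
  by apply: big1 => j _; rewrite !mxE eI eJ /= nth_enum_lift -?IJ // G0l mul0r.
- move=> IJ; rewrite IJ in cI; rewrite (minorE _ _ (esym cI)).
  rewrite (expand_det_col _ ord0).
  by apply: big1 => j _; rewrite !mxE eI eJ /= nth_enum_lift ?IJ // Gl0 mul0r.
- move=> IJ; rewrite (minorE _ _ (esym cI)) expr0 mul1r; congr (\det _).
  by apply/matrixP => a b; rewrite !mxE eI eJ !nth_enum_lift -?IJ.
Qed.

Lemma invmx_lorentz (F : fieldType) n (g : 'M[F]_n) :
  invmx (block_mx (- 1%:M) 0 0 g : 'M[F]_(1 + n)) =
  block_mx (- 1)%:M 0 0 (invmx g).
Proof.
have i1 : invmx (- 1%:M) = (-1)%:M :> 'M[F]_1.
  by rewrite -[- 1%:M]scaleN1r scalemx1 invmx_scalar invrN1.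
have eU : (block_mx (- 1%:M) 0 0 g : 'M[F]_(1 + n)) \in unitmx = (g \in unitmx).
  by rewrite !unitmxE det_ublock det_mx11 !mxE mulN1r unitrN.
have [ug|nug] := boolP (g \in unitmx); first by rewrite invmx_block_diag ?eU ?i1.
(* On singular matrices [invmx] is the identity, so here both sides are the block matrix itself. *)
rewrite !invmx_out ?inE /= ?eU //; congr block_mx.
by rewrite -[- 1%:M]scaleN1r scalemx1.
Qed.

Lemma card_pred_lt n (I J : {set 'I_n}) :
  #|[pred p : 'I_n * 'I_n | [&& p.1 \in I, p.2 \in J & (p.2 < p.1)%N]]| =
  (\sum_(i in I) \sum_(j in J | (j < i)%N) 1)%N.
Proof.
rewrite -sum1_card pair_big_dep /=; apply: eq_bigl => p.
by rewrite !inE.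
Qed.

(** The index 0 lies below every lifted index; its contribution is the sign for moving dx^k past
    dt. *)
Lemma card_lt_lift n (K : {set 'I_n.+1}) (k : 'I_n) :
  #|[pred j in K | (j < lift ord0 k)%N]| =
  ((ord0 \in K) + #|[pred j in lift ord0 @^-1: K | (j < k)%N]|)%N.
Proof.
rewrite -!sum1_card big_mkcond big_ord_recl [in RHS]big_mkcond /=; congr addn.
  by rewrite !inE andbT; case: ifP.
by apply: eq_bigr => j _; rewrite !inE.
Qed.

(** If dt occurs in the second factor, it has to pass every space-like dx^i of the first, one
    inversion each. A factor dt in the first is already in place. *)
Lemma shuffle_sign_lift (R : nzRingType) n (I J : {set 'I_n.+1}) :
  shuffle_sign R I J =
  (-1) ^+ ((ord0 \in J) * #|lift ord0 @^-1: I|) *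
  shuffle_sign R (lift ord0 @^-1: I) (lift ord0 @^-1: J).
Proof.
rewrite /shuffle_sign -exprD; congr (_ ^+ _); rewrite !card_pred_lt.
rewrite [LHS]big_mkcond big_ord_recl [X in _ X _ = _](_ : _ = 0%N); last first.
  by case: ifP => // _; apply: big1 => j; rewrite ltn0 andbF.
rewrite /= add0n mulnC -sum_nat_const -big_split [RHS]big_mkcond /=.
apply: eq_bigr => i _; rewrite !inE; case: ifP => // _.
rewrite !sum1_card; exact: card_lt_lift.
Qed.

Section Lorentz.
Context {R : realType} {n : nat} {V : lmodType R} (g : 'M[R]_n.+1).
Let G : 'M[R]_n.+2 := block_mx (- 1%:M) 0 0 g : 'M[R]_(1 + n.+1).

Lemma sqrt_det_lorentz : Num.sqrt `|\det G| = Num.sqrt `|\det g|.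
Proof.
have -> : \det G = - \det g; last by rewrite normrN.
have := det_ublock (- 1%:M : 'M[R]_1) 0 g.
by rewrite det_mx11 !mxE mulN1r => H; exact: H.
Qed.

Lemma minor_lorentz (I J : {set 'I_n.+2}) : #|I| = #|J| ->
  minor (invmx G) I J =
  if (ord0 \in I) == (ord0 \in J)
  then (- 1) ^+ (ord0 \in I) *
       minor (invmx g) (lift ord0 @^-1: I) (lift ord0 @^-1: J)
  else 0.
Proof. by rewrite /G invmx_lorentz; apply: minor_block. Qed.

Lemma setC_lift (J : {set 'I_n.+2}) :
  lift ord0 @^-1: (~: J) = ~: (lift ord0 @^-1: J).
Proof. by apply/setP => k; rewrite !inE. Qed.

(** Inverse of the map sending a set to its membership bit at 0 and its space-like part; it
    reindexes the sums in [hodge]. *)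
Definition join_ord (b : bool) (K : {set 'I_n.+1}) : {set 'I_n.+2} :=
  [set k | if unlift ord0 k is Some j then j \in K else b].

Lemma join_ord0 b K : (ord0 \in join_ord b K) = b.
Proof. by rewrite inE unlift_none. Qed.

Lemma join_ordK b (K : {set 'I_n.+1}) : lift ord0 @^-1: join_ord b K = K.
Proof. by apply/setP => k; rewrite !inE liftK. Qed.

Lemma join_ord_lift (K : {set 'I_n.+2}) :
  join_ord (ord0 \in K) (lift ord0 @^-1: K) = K.
Proof.
by apply/setP => k; rewrite inE; case: unliftP => [j|] ->; rewrite ?inE.
Qed.

Lemma card_join_ord b (K : {set 'I_n.+1}) : #|join_ord b K| = (b + #|K|)%N.
Proof. by rewrite card_ord_lift join_ord0 join_ordK. Qed.

(* b = true when w has no factor dt, and b = false when w = dt /\ a. *)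
Lemma hodge_lorentz (w : {set 'I_n.+2} -> V) (b : bool) :
  (forall I : {set 'I_n.+2}, (ord0 \in I) = b -> w I = 0) ->
  forall J : {set 'I_n.+2},
  hodge G w J =
  if ord0 \in J == b then
    if b then
      hodge g (fun K : {set 'I_n.+1} => (-1) ^+ #|K| *: w (join_ord false K))
        (lift ord0 @^-1: J)
    else - hodge g (fun K => w (join_ord true K)) (lift ord0 @^-1: J)
  else 0.
Proof.
move=> w0 J; rewrite /hodge sqrt_det_lorentz shuffle_sign_lift setC_lift.
set J' := lift ord0 @^-1: J.
have cJ : #|~: J| = ((ord0 \notin J) + #|~: J'|)%N.
  by rewrite card_ord_lift setC_lift inE.
(* A term survives only if 0 lies in both or neither of [~: J] and I (block minor) and I is in the
   support allowed for w. These conditions are incompatible unless [(ord0 \in J) = b]. *)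
rewrite (eq_bigr (fun I : {set 'I_n.+2} =>
    if ((ord0 \notin J) == (ord0 \in I)) && (b != (ord0 \in I)) then
      ((-1) ^+ (ord0 \notin J) * minor (invmx g) (~: J') (lift ord0 @^-1: I))
        *: w I
    else 0)); last first.
  move=> I /eqP IJ; rewrite minor_lorentz // inE setC_lift.
  case: eqP => _ /=; last by rewrite scale0r.
  by case: eqP => //= /esym/w0 ->; rewrite scaler0.
rewrite -big_mkcondr /=.
have [jb|jb] := eqVneq (ord0 \in J) b; last first.
  rewrite big_pred0 ?scaler0 // => I; apply/negP => /and3P[_ /eqP <-].
  by move: jb; case: (ord0 \in J); case: b w0.
rewrite (reindex_onto (join_ord (~~ b))
    (fun I : {set 'I_n.+2} => lift ord0 @^-1: I : {set 'I_n.+1})) /=; last first.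
  move=> I /and3P[_ _ bI]; rewrite -[RHS]join_ord_lift; congr join_ord.
  by case: b bI w0 {jb}; case: (ord0 \in I).
under eq_bigl => K do
  rewrite join_ordK eqxx andbT join_ord0 card_join_ord cJ jb eqxx /= eqn_add2l.
rewrite (eq_bigl (fun K : {set 'I_n.+1} => #|K| == #|~: J'|)); last first.
  by move=> K; case: b w0 jb => ? ?; rewrite /= ?andbT.
(* For b true the sign is that of the shuffle, with exponent [#|~: J'|], equal to [#|K|] in every
   term. For b false it is the entry -1 of the inverse metric. *)
rewrite {}jb; case: b w0 => w0 /=.
  rewrite mul1n mulrCA [X in X *: _]mulrC -[LHS]scalerA; congr (_ *: _).
  rewrite scaler_sumr; apply: eq_bigr => K /eqP ->.
  by rewrite join_ordK !scalerA mul1r mulrC.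
rewrite mul0n mul1r -scalerN -sumrN; congr (_ *: _); apply: eq_bigr => K _.
by rewrite join_ordK mulN1r scaleNr.
Qed.

End Lorentz.

Lemma hodge_opp (R : realType) n (V : lmodType R) (g : 'M[R]_n.+1)
    (c : {set 'I_n.+1} -> V) K :
  hodge g (fun I => - c I) K = - hodge g c K.
Proof.
by rewrite /hodge -scalerN -sumrN; congr (_ *: _); apply: eq_bigr => I _;
  rewrite scalerN.
Qed.

(** At K only sets I of cardinal [n.+1 - #|K|] contribute, and this has the parity of
    [n.+1 + #|K|]. *)
Lemma hodge_sign (R : realType) n (V : lmodType R) (g : 'M[R]_n.+1)
    (c : {set 'I_n.+1} -> V) K :
  hodge g (fun I : {set 'I_n.+1} => (-1) ^+ #|I| *: c I) K =
  (-1) ^+ (n.+1 + #|K|) *: hodge g c K.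
Proof.
rewrite /hodge [RHS]scalerA [X in _ = X *: _]mulrC -[RHS]scalerA
  [X in _ = _ *: X]scaler_sumr; congr (_ *: _).
apply: eq_bigr => I /eqP ->; rewrite !scalerA mulrC; congr (_ * _ *: _).
rewrite -[X in (X + _)%N](card_ord n.+1) -(cardsC K) addnAC exprD addnn.
by rewrite -mul2n exprM sqrrN !expr1n mul1r.
Qed.

Lemma dx_wedge_opp n (V : zmodType) k (c : {set 'I_n} -> V) K :
  dx_wedge k (fun I => - c I) K = - dx_wedge k c K.
Proof. by rewrite /dx_wedge; case: ifP; rewrite ?oppr0 // mulNrz. Qed.

(** * Sections on space-time *)

(* No differentiability is needed: a divergent difference quotient has limit 0,
   and so has its opposite. *)
Lemma pderivN (R : realType) n (k : 'I_n) (f : 'rV[R]_n -> R) y :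
  pderiv k (fun z => - f z) y = - pderiv k f y.
Proof.
rewrite /pderiv /derive.
set q := (X in _ = - lim (X @ _)%classic).
have -> : (fun h : R =>
    h^-1 *: (((fun z => - f z) \o shift y) (h *: delta_mx 0 k) - - f y)) = - q.
  by apply/funext => h; rewrite /q /= opprfctE -scalerN opprD.
have [cq|dq] := pselect (cvg (q @ 0^'))%classic; first by rewrite limN.
have dN : ~ cvg (- q @ 0^')%classic by rewrite is_cvgNE.
by rewrite (dvgP dq) (dvgP dN) oppr0.
Qed.

Lemma near_eq_pderiv (R : realType) n (k : 'I_n) (f g : 'rV[R]_n -> R) y :
  (\near y, f y = g y) -> pderiv k f y = pderiv k g y.
Proof. exact: near_eq_derive. Qed.

Lemma open_patch (R : realType) (M : spacetime R) (i : chart M) :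
  open (Defs.patch i).
Proof.
have -> : Defs.patch i =
    (@time_coord R @^-1` time M `&`
     @space_coord R @^-1` (Defs.coord i @` dom i))%classic.
  by [].
apply: openI; apply: open_comp => //.
- by move=> y _; apply: coord_continuous.
- exact: time_open.
- by move=> y _; apply: continuous_rsubmx.
- exact: coord_open.
Qed.

Section Values.
Context {R : realType} {r : nat} {v : values}.

Lemma connection_act0 (B : 'M[R]_r) : connection_act (v := v) B 0 = 0.
Proof. by case: v => /=; rewrite ?mulmx0 ?mul0mx ?oppr0 ?addr0. Qed.

Lemma connection_actN (B : 'M[R]_r) (s : fibre R r v) :
  connection_act B (- s) = - connection_act B s.
Proof. by case: v s => s /=; rewrite ?mulmxN ?mulNmx ?oppr0 ?opprD. Qed.

Lemma musical0 (H : 'M[R]_r) : musical (v := v) H 0 = 0.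
Proof. by case: v => /=; rewrite ?trmx0 ?mulmx0 ?mul0mx. Qed.

Lemma musicalZ (H : 'M[R]_r) c (s : fibre R r v) :
  musical H (c *: s) = c *: musical H s.
Proof. by case: v s => s //=; rewrite linearZ /= -?scalemxAl -?scalemxAr. Qed.

Lemma musicalN (H : 'M[R]_r) (s : fibre R r v) :
  musical H (- s) = - musical H s.
Proof. by rewrite -scaleN1r musicalZ scaleN1r. Qed.

End Values.

Section Forms.
Context {R : realType} {M : spacetime R} {r : nat} {E : metric_bundle M r}.
Local Notation timelike a := (dt_wedge (on_Omega a)).

(** Identities between operators are proved as equalities of functions, off the patches too, so that
    they can be rewritten under derivatives. *)
Lemma lform_ext n v (a b : lform E n v) :
  (forall i y K, a i y K = b i y K) -> a = b.
Proof. by move=> ab; do 3!apply/funext => ?. Qed.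

(** The connection acts on each coefficient separately; this is its action on one fibre-valued
    function, whatever index set and dimension it comes from. *)
Definition nabla_coef v (k : 'I_4) (i : chart M) (s : 'rV[R]_4 -> fibre R r v) :
    'rV[R]_4 -> fibre R r v :=
  fun y => \matrix_(a, b) pderiv k (fun z => s z a b) y
           + connection_act (A E i k y) (s y).

Lemma nablaE n v (k : 'I_4) (w : lform E n v) i y K :
  nabla k w i y K = nabla_coef k i (fun z => w i z K) y.
Proof. by []. Qed.

Lemma nabla_coef0 v k i y : nabla_coef k i (fun=> 0 : fibre R r v) y = 0.
Proof.
rewrite /nabla_coef connection_act0 addr0; apply/matrixP => a b; rewrite !mxE.
by rewrite -[RHS](derive_cst 0 y (delta_mx 0 k)); congr ('D_ _ _ _).
Qed.

Lemma nabla_coefN v k i (s : 'rV[R]_4 -> fibre R r v) y :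
  nabla_coef k i (fun z => - s z) y = - nabla_coef k i s y.
Proof.
rewrite /nabla_coef connection_actN opprD; congr (_ + _).
apply/matrixP => a b; rewrite [LHS]mxE [RHS]mxE [X in - X]mxE -pderivN.
by under eq_fun do rewrite mxE.
Qed.

Lemma nabla_coef_sign v k i m (s : 'rV[R]_4 -> fibre R r v) y :
  nabla_coef k i (fun z => (-1) ^+ m *: s z) y = (-1) ^+ m *: nabla_coef k i s y.
Proof.
have [->|->] : (-1) ^+ m = 1 :> R \/ (-1) ^+ m = - 1 :> R.
  by rewrite -signr_odd; case: (odd m); [right|left].
- by rewrite scale1r; under eq_fun do rewrite scale1r.
- by rewrite scaleN1r -nabla_coefN; under eq_fun do rewrite scaleN1r.
Qed.

(** No index precedes 0, so wedging with dt on the left produces no sign. *)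
Lemma timelikeE v (a : lform E 3 v) i y K :
  timelike a i y K = if ord0 \in K then a i y (lift ord0 @^-1: K) else 0.
Proof.
rewrite /dt_wedge /dx_wedge /on_Omega; case: ifP => // _.
rewrite eq_card0 ?mulr1z; last by move=> j; rewrite !inE ltn0 andbF.
by rewrite !inE eqxx /=; congr (a i y _); apply/setP => j; rewrite !inE.
Qed.

Section Linearity.
Context {v : values}.
Implicit Types (a b : lform E 3 v) (w : lform E 4 v).

Lemma form_oppK n (a : lform E n v) : -f (-f a) = a.
Proof. by apply: lform_ext => i y K; rewrite /Defs.opp opprK. Qed.

Lemma nabla_opp n k (a : lform E n v) : nabla k (-f a) = -f (nabla k a).
Proof. by apply: lform_ext => i y K; rewrite /Defs.opp !nablaE nabla_coefN. Qed.

Lemma d_s_opp a : d_s (-f a) = -f (d_s a).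
Proof.
apply: lform_ext => i y K; rewrite /d_s /Defs.opp -sumrN; apply: eq_bigr => k _.
by rewrite -dx_wedge_opp nabla_opp.
Qed.

Lemma ds_opp w : ds (-f w) = -f (ds w).
Proof.
apply: lform_ext => i y K; rewrite /ds /Defs.opp -sumrN; apply: eq_bigr => k _.
by rewrite -dx_wedge_opp nabla_opp.
Qed.

Lemma dt_wedge_opp w : dt_wedge (-f w) = -f (dt_wedge w).
Proof. by apply: lform_ext => i y K; rewrite /dt_wedge /Defs.opp dx_wedge_opp. Qed.

Lemma on_Omega_opp a : on_Omega (-f a) = -f (on_Omega a).
Proof. by apply: lform_ext => i y K; rewrite /on_Omega /Defs.opp; case: ifP; rewrite ?oppr0. Qed.

Lemma star_opp w : star (-f w) = -f (star w).
Proof. by apply: lform_ext => i y K; rewrite /star /Defs.opp hodge_opp musicalN. Qed.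

Lemma star_s_opp a : star_s (-f a) = -f (star_s a).
Proof. by apply: lform_ext => i y K; rewrite /star_s /Defs.opp hodge_opp musicalN. Qed.

Lemma timelikeD a b : timelike a +f timelike b = timelike (a +f b).
Proof.
by apply: lform_ext => i y K; rewrite /Defs.add !timelikeE; case: ifP; rewrite ?addr0.
Qed.

Lemma on_OmegaD a b : on_Omega a +f on_Omega b = on_Omega (a +f b).
Proof.
by apply: lform_ext => i y K; rewrite /Defs.add /on_Omega; case: ifP; rewrite ?addr0.
Qed.

End Linearity.

(** * Derivatives of space-like and time-like forms *)

Section Splitting.
Context {v : values}.
Implicit Types (a b : lform E 3 v) (w : lform E 4 v).

Lemma nabla_on_Omega k a : nabla k (on_Omega a) = on_Omega (nabla k a).
Proof.
apply: lform_ext => i y K; rewrite /on_Omega !nablaE.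
by case: ifP => _ //; rewrite nabla_coef0.
Qed.

Lemma nabla_timelike k a : nabla k (timelike a) = timelike (nabla k a).
Proof.
apply: lform_ext => i y K; rewrite timelikeE !nablaE.
rewrite (_ : (fun z => _) =
  (fun z => if ord0 \in K then a i z (lift ord0 @^-1: K) else 0)).
  by case: ifP => _ //; rewrite nabla_coef0.
by apply/funext => z; rewrite timelikeE.
Qed.

Lemma dt_partial_t_on_Omega a :
  dt_partial_t (on_Omega a) = timelike (partial_t a).
Proof. by rewrite /dt_partial_t nabla_on_Omega. Qed.

Lemma preimset_liftD1 (K : {set 'I_4}) (k : 'I_3) :
  lift ord0 @^-1: (finset.setD K [set lift ord0 k]) =
  finset.setD (lift ord0 @^-1: K) [set k].
Proof. by apply/setP => j; rewrite !inE (inj_eq lift_inj). Qed.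

Lemma ds_on_Omega a : ds (on_Omega a) = on_Omega (d_s a).
Proof.
apply: lform_ext => i y K; rewrite /ds /d_s /on_Omega.
case: ifPn => K0.
  apply: big1 => k _; rewrite nabla_on_Omega /dx_wedge /on_Omega.
  by case: ifP => // _; rewrite !inE K0 neq_lift mul0rz.
apply: eq_bigr => k _; rewrite nabla_on_Omega /dx_wedge /on_Omega !inE.
rewrite (negPf K0) andbF; case: ifP => // _.
by rewrite card_lt_lift (negPf K0) preimset_liftD1.
Qed.

(** Each dx^k anticommutes with dt: 0 is one more index below [lift ord0 k]. *)
Lemma ds_timelike a : ds (timelike a) = -f (timelike (d_s a)).
Proof.
apply: lform_ext => i y K; rewrite /ds /Defs.opp timelikeE /d_s.
case: ifPn => K0.
  rewrite -sumrN; apply: eq_bigr => k _; rewrite nabla_timelike /dx_wedge !inE.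
  case: ifP => _; last by rewrite oppr0.
  rewrite timelikeE !inE K0 neq_lift /= card_lt_lift K0 exprD expr1 mulN1r.
  by rewrite mulrNz preimset_liftD1.
rewrite oppr0; apply: big1 => k _; rewrite nabla_timelike /dx_wedge.
by case: ifP => // _; rewrite timelikeE !inE (negPf K0) andbF mul0rz.
Qed.

End Splitting.

(* The operator # of the header.  The sign is not factored out as (-1)^p
   because nothing constrains the degree of local expressions off the patches. *)
Definition grade v (a : lform E 3 v) : lform E 3 v :=
  fun i y K => (-1) ^+ #|K| *: a i y K.

(** * The Hodge operators and the grading sign *)

Section Hodge.
Context {v : values}.
Implicit Types (a b : lform E 3 v) (w : lform E 4 v).

Lemma star_timelike a : star (timelike a) = -f (on_Omega (star_s a)).
Proof.
apply: lform_ext => i y K; rewrite /star /Defs.opp {2}/on_Omega /star_s.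
rewrite (@hodge_lorentz _ _ _ _ _ false) => [|I I0]; last by rewrite timelikeE I0.
case: (ord0 \in K) => /=; first by rewrite musical0 oppr0.
rewrite musicalN; congr (- _); congr (musical _ (hodge _ _ _)).
by apply/funext => I; rewrite timelikeE join_ord0 join_ordK.
Qed.

Lemma star_on_Omega a : star (on_Omega a) = timelike (star_s (grade a)).
Proof.
apply: lform_ext => i y K; rewrite timelikeE /star /star_s.
rewrite (@hodge_lorentz _ _ _ _ _ true) => [|I I0]; last by rewrite /on_Omega I0.
case: (ord0 \in K) => /=; last by rewrite musical0.
congr (musical _ (hodge _ _ _)); apply/funext => I.
by rewrite /on_Omega join_ord0 join_ordK.
Qed.

(** The dimension 3 is odd, so [star_s] reverses the parity of the degree. *)
Lemma star_s_grade a : star_s (grade a) = -f (grade (star_s a)).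
Proof.
apply: lform_ext => i y K; rewrite /star_s /grade /Defs.opp.
by rewrite hodge_sign musicalZ exprD -signr_odd expr1 mulN1r scaleNr.
Qed.

(** The coefficient of [d_s a] at K comes from sets with one element less. *)
Lemma d_s_grade a : d_s (grade a) = -f (grade (d_s a)).
Proof.
apply: lform_ext => i y K; rewrite /d_s /grade /Defs.opp scaler_sumr -sumrN.
apply: eq_bigr => k _; rewrite /dx_wedge.
case: ifP => kK; last by rewrite scaler0 oppr0.
rewrite nablaE nabla_coef_sign -nablaE (cardsD1 k K) kK exprS mulN1r scaleNr opprK.
by rewrite scalerMzr.
Qed.

End Hodge.

(** * The rows of the system *)

Section Costar.
Context {v : values}.

(** [undual] reduces to the identity only once v is a constructor, hence the case analysis. *)
Lemma costar_timelike (a : lform E 3 (dual v)) :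
  costar (timelike a) = -f (on_Omega (costar_s a)).
Proof. by rewrite /costar /costar_s star_timelike; case: v a. Qed.

Lemma costar_on_Omega (a : lform E 3 (dual v)) :
  costar (on_Omega a) = timelike (costar_s (grade a)).
Proof. by rewrite /costar /costar_s star_on_Omega; case: v a. Qed.

Lemma costar_opp (w : lform E 4 (dual v)) : costar (-f w) = -f (costar w).
Proof. by rewrite /costar star_opp; case: v w. Qed.

Lemma costar_s_opp (a : lform E 3 (dual v)) : costar_s (-f a) = -f (costar_s a).
Proof. by rewrite /costar_s star_s_opp; case: v a. Qed.

Implicit Types (a b : lform E 3 v).

(** The outer star creates [grade], which anticommutes with both [d_s] and [star_s] and so reaches a
    without a sign. *)
Lemma costar_ds_star_timelike a :
  costar (ds (star (timelike a))) =
  -f timelike (costar_s (d_s (star_s (grade a)))).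
Proof.
rewrite star_timelike ds_opp ds_on_Omega costar_opp costar_on_Omega.
by rewrite star_s_grade d_s_opp d_s_grade form_oppK.
Qed.

(** The inner star creates [grade]. The minus signs of [ds] past dt and of the outer star cancel. *)
Lemma costar_ds_star_on_Omega a :
  costar (ds (star (on_Omega a))) =
  on_Omega (costar_s (d_s (star_s (grade a)))).
Proof.
by rewrite star_on_Omega ds_timelike costar_opp costar_timelike form_oppK.
Qed.

(** Both stars act on time-like forms, and their two minus signs cancel. *)
Lemma costar_dt_star_timelike a :
  costar (dt_partial_t (star (timelike a))) =
  on_Omega (costar_s (partial_t (star_s a))).
Proof.
rewrite star_timelike /dt_partial_t nabla_opp dt_wedge_opp costar_opp.
by rewrite nabla_on_Omega costar_timelike form_oppK.
Qed.

End Costar.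

(** * Compatibility of the operators with equality on the patches *)

Lemma near_eq_nabla v n k (a b : lform E n v) : a =f b -> nabla k a =f nabla k b.
Proof.
move=> ab i y Py K; rewrite /nabla (ab i y Py); congr (_ + _).
apply/matrixP => c d; rewrite !mxE; apply: near_eq_pderiv.
(* A patch is open, so equality on it holds near y, and a partial derivative depends only on the
   germ at y. *)
have : (\near y, Defs.patch i y).
  by apply: open_nbhs_nbhs; split => //; apply: open_patch.
by apply: filterS => z Pz; rewrite ab.
Qed.

Lemma form_eq_opp v n (a b : lform E n v) : a =f b -> -f a =f -f b.
Proof. by move=> ab i y Py K; rewrite /Defs.opp ab. Qed.

Lemma form_eq_addl v n (a b c : lform E n v) : a =f b -> a +f c =f b +f c.
Proof. by move=> ab i y Py K; rewrite /Defs.add ab. Qed.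

Lemma form_eq_addr v n (c a b : lform E n v) : a =f b -> c +f a =f c +f b.
Proof. by move=> ab i y Py K; rewrite /Defs.add ab. Qed.

Lemma form_eq_d_s v (a b : lform E 3 v) : a =f b -> d_s a =f d_s b.
Proof.
move=> ab i y Py K; apply: eq_bigr => k _; rewrite /dx_wedge.
by rewrite (near_eq_nabla _ ab Py).
Qed.

Lemma form_eq_ds v (a b : lform E 4 v) : a =f b -> ds a =f ds b.
Proof.
move=> ab i y Py K; apply: eq_bigr => k _; rewrite /dx_wedge.
by rewrite (near_eq_nabla _ ab Py).
Qed.

Lemma form_eq_dt_partial_t v (a b : lform E 4 v) :
  a =f b -> dt_partial_t a =f dt_partial_t b.
Proof.
move=> ab i y Py K; rewrite /dt_partial_t /dt_wedge /dx_wedge.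
by rewrite (near_eq_nabla _ ab Py).
Qed.

Lemma form_eq_star_s v (a b : lform E 3 v) : a =f b -> star_s a =f star_s b.
Proof.
move=> ab i y Py K; rewrite /star_s; congr (musical _ (hodge _ _ _)).
by apply/funext => I; apply: ab.
Qed.

Lemma form_eq_costar_s v (a b : lform E 3 (dual v)) :
  a =f b -> costar_s a =f costar_s b.
Proof. by move/form_eq_star_s; rewrite /costar_s; case: v a b. Qed.

Lemma timelike_inj v (a b : lform E 3 v) : timelike a =f timelike b <-> a =f b.
Proof.
split=> ab i y Py K; last by rewrite !timelikeE (ab i y Py).
have := ab i y Py (join_ord true K).
by rewrite !timelikeE join_ord0 join_ordK.
Qed.

Lemma on_Omega_inj v (a b : lform E 3 v) : on_Omega a =f on_Omega b <-> a =f b.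
Proof.
split=> ab i y Py K; last by rewrite /on_Omega (ab i y Py).
have := ab i y Py (join_ord false K).
by rewrite /on_Omega join_ord0 join_ordK.
Qed.

Lemma form_eq_iffl v n (c a b : lform E n v) :
  a =f b -> a =f c <-> b =f c.
Proof. by move=> ab; split=> H i y Py K; have := H i y Py K; rewrite ab. Qed.

Lemma form_eq_iffr v n (a b c : lform E n v) :
  b =f c -> a =f b <-> a =f c.
Proof. by move=> bc; split=> H i y Py K; have := H i y Py K; rewrite bc. Qed.

(** * Homogeneous components *)

Section Degree.
Context {v : values} {p : nat}.

Definition has_degree n (a : lform E n v) q :=
  forall i y, Defs.patch i y -> forall K : {set 'I_n}, #|K| != q -> a i y K = 0.

Lemma grade_degree (a : lform E 3 v) q : has_degree a q ->
  grade a =f if odd q then -f a else a.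
Proof.
move=> aq i y Py K; rewrite /grade; have [<-|Kq] := eqVneq #|K| q.
  rewrite -signr_odd; case: (odd _); last by rewrite scale1r.
  by rewrite expr1 scaleN1r.
by case: (odd q); rewrite /Defs.opp (aq i y Py K Kq) scaler0 ?oppr0.
Qed.

(** On a homogeneous form [grade] is a constant sign, which passes through the three operators; this
    yields the signs of the second system. *)
Lemma hodge_laplacian_grade (a : lform E 3 v) q : has_degree a q ->
  costar_s (d_s (star_s (grade a))) =f
  if odd q then -f costar_s (d_s (star_s a)) else costar_s (d_s (star_s a)).
Proof.
move=> /grade_degree aq.
have -> : (if odd q then -f costar_s (d_s (star_s a))
           else costar_s (d_s (star_s a))) =
          costar_s (d_s (star_s (if odd q then -f a else a))).
  by case: (odd q); rewrite // star_s_opp d_s_opp costar_s_opp.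
by apply: form_eq_costar_s; apply: form_eq_d_s; apply: form_eq_star_s.
Qed.

Lemma degree_time_coef (w : pform E v p.+1) : has_degree (time_coef w) p.
Proof.
move=> i y Py K Kp; apply: pform_degree => //.
rewrite finset.cardsU1 card_imset; last exact: lift_inj.
rewrite (_ : _ \in _ = false) //; apply/negP => /imsetP[k _ /eqP].
by rewrite (negPf (neq_lift _ _)).
Qed.

Lemma degree_space_coef (w : pform E v p) : has_degree (space_coef w) p.
Proof.
move=> i y Py K Kp; apply: pform_degree => //.
by rewrite card_imset //; exact: lift_inj.
Qed.

(** The first system leaves 0-forms unsplit. A set containing 0 is nonempty, so the degree condition
    kills its coefficient. *)
Lemma pform0_on_Omega (w : pform E v 0) : w =f on_Omega (space_coef w).
Proof.
move=> i y Py K; rewrite /on_Omega /space_coef; case: ifPn => K0.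
  by apply: pform_degree; rewrite // -lt0n; apply/card_gt0P; exists ord0.
by rewrite lift0_imset.
Qed.

End Degree.

Section Rows.
Context {v : values}.
Local Notation time := time_coef.
Local Notation space := space_coef.

(** Rows 1, 3, 6 and 8 involve only odd degrees of the field f and even degrees of g, hence a single
    value bundle v. *)
Lemma odd_rows (f1 : pform E v 1) (f3 : pform E v 3) (g0 : pform E v 0)
    (g2 : pform E v 2) (g4 : pform E v 4) :
  [/\ dt_partial_t (space_part f3) +f ds (time_part f3) =f time_part g4 <->
      partial_t (space f3) +f -f d_s (time f3) =f time g4,
      dt_partial_t (space_part f1) +f -f costar (ds (star (time_part f3)))
        +f ds (time_part f1) =f time_part g2 <->
      partial_t (space f1) +f costar_s (d_s (star_s (time f3)))
        +f -f d_s (time f1) =f time g2,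
      -f costar (ds (star (space_part f3))) +f ds (space_part f1)
        +f -f costar (dt_partial_t (star (time_part f3))) =f space_part g2 <->
      costar_s (d_s (star_s (space f3))) +f d_s (space f1)
        +f -f costar_s (partial_t (star_s (time f3))) =f space g2 &
      -f costar (ds (star (space_part f1)))
        +f -f costar (dt_partial_t (star (time_part f1))) =f g0 <->
      costar_s (d_s (star_s (space f1)))
        +f -f costar_s (partial_t (star_s (time f1))) =f space g0].
Proof.
have dF3 := hodge_laplacian_grade (degree_time_coef f3).
have df1 := hodge_laplacian_grade (degree_space_coef f1).
have df3 := hodge_laplacian_grade (degree_space_coef f3).
rewrite /space_part /time_part; split.
- rewrite dt_partial_t_on_Omega ds_timelike -dt_wedge_opp -on_Omega_opp timelikeD.
  exact: timelike_inj.
- rewrite dt_partial_t_on_Omega costar_ds_star_timelike form_oppK ds_timelike.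
  rewrite -dt_wedge_opp -on_Omega_opp !timelikeD.
  apply: iff_trans (timelike_inj _ _) _; apply: form_eq_iffl.
  by apply: form_eq_addl; apply: form_eq_addr; exact: dF3.
- rewrite costar_ds_star_on_Omega ds_on_Omega costar_dt_star_timelike.
  rewrite -!on_Omega_opp !on_OmegaD.
  apply: iff_trans (on_Omega_inj _ _) _; apply: form_eq_iffl.
  apply: form_eq_addl; apply: form_eq_addl.
  (* The degree 3 is odd, so the grading sign cancels the minus sign of the row. *)
  by rewrite -[X in _ =f X]form_oppK; apply: form_eq_opp; exact: df3.
- rewrite costar_ds_star_on_Omega costar_dt_star_timelike -!on_Omega_opp on_OmegaD.
  apply: iff_trans (form_eq_iffr _ (pform0_on_Omega g0)) _.
  apply: iff_trans (on_Omega_inj _ _) _; apply: form_eq_iffl.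
  apply: form_eq_addl.
  by rewrite -[X in _ =f X]form_oppK; apply: form_eq_opp; exact: df1.
Qed.

(** These are rows 2, 4, 5 and 7, of the opposite parity. The grading sign is -1 for F^1_s and
    F^3_s, and 1 for f^2_s. *)
Lemma even_rows (f0 : pform E v 0) (f2 : pform E v 2) (f4 : pform E v 4)
    (g1 : pform E v 1) (g3 : pform E v 3) :
  [/\ costar (dt_partial_t (star (time_part f4))) +f ds (space_part f2)
        =f space_part g3 <->
      costar_s (partial_t (star_s (time f4))) +f d_s (space f2) =f space g3,
      costar (dt_partial_t (star (time_part f2)))
        +f costar (ds (star (space_part f2))) +f ds f0 =f space_part g1 <->
      costar_s (partial_t (star_s (time f2)))
        +f costar_s (d_s (star_s (space f2))) +f d_s (space f0) =f space g1,
      costar (ds (star (time_part f4))) +f ds (time_part f2)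
        +f dt_partial_t (space_part f2) =f time_part g3 <->
      costar_s (d_s (star_s (time f4))) +f -f d_s (time f2)
        +f partial_t (space f2) =f time g3 &
      costar (ds (star (time_part f2))) +f dt_partial_t f0 =f time_part g1 <->
      costar_s (d_s (star_s (time f2))) +f partial_t (space f0) =f time g1].
Proof.
have dF2 := hodge_laplacian_grade (degree_time_coef f2).
have dF4 := hodge_laplacian_grade (degree_time_coef f4).
have df2 := hodge_laplacian_grade (degree_space_coef f2).
rewrite /space_part /time_part; split.
- rewrite costar_dt_star_timelike ds_on_Omega on_OmegaD; exact: on_Omega_inj.
- rewrite costar_dt_star_timelike costar_ds_star_on_Omega.
  have /form_eq_ds := pform0_on_Omega f0; rewrite ds_on_Omega => f0s.
  apply: iff_trans (form_eq_iffl _ (form_eq_addr _ f0s)) _.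
  rewrite !on_OmegaD; apply: iff_trans (on_Omega_inj _ _) _.
  by apply: form_eq_iffl; apply: form_eq_addl; apply: form_eq_addr; exact: df2.
- rewrite costar_ds_star_timelike ds_timelike dt_partial_t_on_Omega.
  rewrite -!dt_wedge_opp -!on_Omega_opp !timelikeD.
  apply: iff_trans (timelike_inj _ _) _; apply: form_eq_iffl.
  apply: form_eq_addl; apply: form_eq_addl.
  by rewrite -[X in _ =f X]form_oppK; apply: form_eq_opp; exact: dF4.
- rewrite costar_ds_star_timelike -dt_wedge_opp -on_Omega_opp.
  have /form_eq_dt_partial_t := pform0_on_Omega f0.
  rewrite dt_partial_t_on_Omega => f0s.
  apply: iff_trans (form_eq_iffl _ (form_eq_addr _ f0s)) _.
  rewrite timelikeD; apply: iff_trans (timelike_inj _ _) _.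
  apply: form_eq_iffl; apply: form_eq_addl.
  by rewrite -[X in _ =f X]form_oppK; apply: form_eq_opp; exact: dF2.
Qed.

End Rows.

End Forms.

Lemma and_iff_congr (P P' Q Q' : Prop) :
  (P <-> P') -> (Q <-> Q') -> (P /\ Q <-> P' /\ Q').
Proof. by move=> [? ?] [? ?]; split=> -[]; auto. Qed.

Theorem corollary3p13 (R : realType) (M : spacetime R) (r : nat)
    (E : metric_bundle M r) (k : field_kind)
    (f : general_field E (values_of k))
    (g : general_field E (fun odd_degree => values_of k (negb odd_degree))) :
  let fs p := space_part (f p) in
  let ft p := time_part (f p) in
  let gs p := space_part (g p) in
  let gt p := time_part (g p) in
  (* as forms on Omega_s: the space-like parts, and F^p_s = F p, G^p_s = G p *)
  let fs' p := space_coef (f p) in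
  let gs' p := space_coef (g p) in
  let F p := time_coef (f p.+1) in
  let G p := time_coef (g p.+1) in
  (  dt_partial_t (fs 3) +f ds (ft 3) =f gt 4
  /\ costar (dt_partial_t (star (ft 4))) +f ds (fs 2) =f gs 3
  /\ dt_partial_t (fs 1) +f -f costar (ds (star (ft 3))) +f ds (ft 1) =f gt 2
  /\ costar (dt_partial_t (star (ft 2))) +f costar (ds (star (fs 2)))
       +f ds (f 0) =f gs 1
  /\ costar (ds (star (ft 4))) +f ds (ft 2) +f dt_partial_t (fs 2) =f gt 3
  /\ -f costar (ds (star (fs 3))) +f ds (fs 1)
       +f -f costar (dt_partial_t (star (ft 3))) =f gs 2
  /\ costar (ds (star (ft 2))) +f dt_partial_t (f 0) =f gt 1
  /\ -f costar (ds (star (fs 1)))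
       +f -f costar (dt_partial_t (star (ft 1))) =f g 0)
  <->
  (  partial_t (fs' 3) +f -f d_s (F 2) =f G 3
  /\ costar_s (partial_t (star_s (F 3))) +f d_s (fs' 2) =f gs' 3
  /\ partial_t (fs' 1) +f costar_s (d_s (star_s (F 2))) +f -f d_s (F 0) =f G 1
  /\ costar_s (partial_t (star_s (F 1))) +f costar_s (d_s (star_s (fs' 2)))
       +f d_s (fs' 0) =f gs' 1
  /\ costar_s (d_s (star_s (F 3))) +f -f d_s (F 1) +f partial_t (fs' 2) =f G 2
  /\ costar_s (d_s (star_s (fs' 3))) +f d_s (fs' 1)
       +f -f costar_s (partial_t (star_s (F 2))) =f gs' 2
  /\ costar_s (d_s (star_s (F 1))) +f partial_t (fs' 0) =f G 0
  /\ costar_s (d_s (star_s (fs' 1)))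
       +f -f costar_s (partial_t (star_s (F 0))) =f gs' 0).
Proof.
move=> fs ft gs gt fs' gs' F G.
(* For numerals [odd] computes, so the values of the odd f and of the even g agree by conversion. *)
have [r1 r3 r6 r8] := odd_rows (f 1) (f 3) (g 0) (g 2) (g 4).
have [r2 r4 r5 r7] := even_rows (f 0) (f 2) (f 4) (g 1) (g 3).
apply: and_iff_congr; first exact: r1.
apply: and_iff_congr; first exact: r2.
apply: and_iff_congr; first exact: r3.
apply: and_iff_congr; first exact: r4.
apply: and_iff_congr; first exact: r5.
apply: and_iff_congr; first exact: r6.
by apply: and_iff_congr; [exact: r7|exact: r8].
Qed.
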